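(* Let $n\ge1$. Then $x_{\llbracket n\rrbracket}$ is $e$-positive in $\mathrm{NCSym}$ if and only if $x_n$ is $e$-positive in $\mathrm{Sym}$.
   Context: A set partition $\pi\vdash[n]$ of $[n]=\{1,\dots,n\}$ is a collection of disjoint nonempty subsets (blocks) with union $[n]$; $\llbracket n\rrbracket$ is the set partition with the single block $[n]$. Set partitions of $[n]$ are ordered by refinement: $\sigma\le\pi$ if each block of $\sigma$ is contained in a block of $\pi$. $u$ is the Möbius function of this lattice: for $\sigma\le\pi$, $u(\sigma,\pi)=\prod_i(-1)^{k_i-1}(k_i-1)!$ where $k_i$ is the number of blocks of $\sigma$ contained in the $i$th block of $\pi$. In $\mathbb{Q}[[\mathbf{x}_1,\mathbf{x}_2,\dots]]$ (noncommuting variables), for $\pi\vdash[n]$: $p_\pi=\sum\mathbf{x}_{i_1}\cdots\mathbf{x}_{i_n}$ over all tuples of positive integers with $i_j=i_k$ whenever $j,k$ are in the same block of $\pi$; $e_\pi=\sum\mathbf{x}_{i_1}\cdots\mathbf{x}_{i_n}$ over all tuples with $i_j\ne i_k$ whenever $j\neq k$ are in the same block of $\pi$; and $x_\pi=\sum_{\sigma\le\pi}u(\sigma,\pi)\,p_\sigma$. $\mathrm{NCSym}$ is the algebra of symmetric functions in noncommuting variables; its degree-$n$ piece has each of $\{p_\pi\}_{\pi\vdash[n]}$, $\{e_\pi\}_{\pi\vdash[n]}$, $\{x_\pi\}_{\pi\vdash[n]}$ as a $\mathbb{Q}$-basis. $\mathrm{Sym}\subset\mathbb{Q}[[x_1,x_2,\dots]]$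 is the algebra of symmetric functions in commuting variables, with its usual elementary basis $e_\lambda=e_{\lambda_1}\cdots e_{\lambda_l}$ indexed by integer partitions $\lambda$, $e_i=\sum_{j_1<\cdots<j_i}x_{j_1}\cdots x_{j_i}$. Let $\rho:\mathbb{Q}[[\mathbf{x}_1,\mathbf{x}_2,\dots]]\to\mathbb{Q}[[x_1,x_2,\dots]]$ be the algebra morphism letting the variables commute ($\mathbf{x}_i\mapsto x_i$). The element $x_n\in\mathrm{Sym}$ (indexed by the integer partition of $n$ with the single part $n$, not a variable) is $x_n=\rho(x_{\llbracket n\rrbracket})$. An element of $\mathrm{NCSym}$ (respectively $\mathrm{Sym}$) is $e$-positive if all coefficients appearing (i.e. all nonzero coefficients) in its expansion in the basis $\{e_\pi\}$ (respectively $\{e_\lambda\}$) are positive. *)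

(* Defs.v *)
From mathcomp Require Import all_boot all_order all_algebra.
From mathcomp Require Import finmap multiset.

Set Implicit Arguments.
Unset Strict Implicit.
Unset Printing Implicit Defensive.

Import Order.TTheory GRing.Theory Num.Theory.

Local Open Scope ring_scope.
Local Open Scope mset_scope.

(* A formal power series is its family of rational coefficients. A            *)
(* noncommutative monomial is a word in the variable indices, a commutative   *)
(* one is a finite multiset of them; nat indexes x_1, x_2, ... from 0.        *)
Definition ncseries := seq nat -> rat.
Definition cseries := {mset nat} -> rat.

(* The words that become the commutative monomial m are exactly the distinct  *)
(* rearrangements of the elements of m, listed by permutations without        *)
(* repetition.                                                                *)
Definition rho (f : ncseries) : cseries :=
  fun m => \sum_(w <- permutations (enum_mset m)) f w.

(* Set partitions of [n] are the P : {set {set 'I_n}} such that               *)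
(* partition P [set: 'I_n].                                                   *)
Definition refines n (S P : {set {set 'I_n}}) : bool :=
  [forall A in S, exists B in P, A \subset B].

Definition one_block n : {set {set 'I_n}} := [set [set: 'I_n]].

Definition mobius n (S P : {set {set 'I_n}}) : rat :=
  \prod_(B in P) (let k := #|[set A in S | A \subset B]| in
                  (-1) ^+ k.-1 * (k.-1)`!%:R).

(* The tuple (i_1, ..., i_n) in the definitions of p_P and e_P is determined  *)
(* by the word x_(i_1) ... x_(i_n), so every coefficient is 0 or 1.           *)
Definition p_nc n (P : {set {set 'I_n}}) : ncseries := fun w =>
  ((size w == n) &&
   [forall B in P, forall j in B, forall k in B,
      nth 0%N w j == nth 0%N w k])%:R.

Definition e_nc n (P : {set {set 'I_n}}) : ncseries := fun w =>
  ((size w == n) &&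
   [forall B in P, forall j in B, forall k in B,
      (j != k) ==> (nth 0%N w j != nth 0%N w k)])%:R.

Definition x_nc n (P : {set {set 'I_n}}) : ncseries := fun w =>
  \sum_(S : {set {set 'I_n}} | partition S [set: 'I_n] && refines S P)
     mobius S P * p_nc S w.

Definition x_sym (n : nat) : cseries := rho (x_nc (one_block n)).

Definition sub_msets (m : {mset nat}) : seq {mset nat} :=
  undup [seq seq_mset (mask b (enum_mset m))
        | b : (size (enum_mset m)).-tuple bool].

Lemma mem_sub_msets (a m : {mset nat}) : (a \in sub_msets m) = (a `<=` m).
Proof.
rewrite mem_undup; apply/imageP/idP => [[b _ ->]|/msubsetP le_am].
  apply/msubsetP => x; rewrite mset_seqE -[m x]count_mem_mset.
  exact/leq_count_subseq/mask_subseq.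
have /count_subseqP[s /subseqP[b sz_b ->] pas] :
    forall x, (count_mem x (enum_mset a) <= count_mem x (enum_mset m))%N.
  by move=> x; rewrite !count_mem_mset.
have sz_bP : size b == size (enum_mset m) by rewrite sz_b.
exists (Tuple sz_bP) => //=; rewrite -[LHS]seq_mset_id.
exact/eq_seq_msetP.
Qed.

Definition cs_one : cseries := fun m => (m == mset0)%:R.

Definition cs_mul (f g : cseries) : cseries := fun m =>
  \sum_(a <- sub_msets m) f a * g (m `\` a).

(* Each squarefree monomial of degree i comes from exactly one sequence       *)
(* j_1 < ... < j_i.                                                           *)
Definition elem (i : nat) : cseries := fun m =>
  ((size (enum_mset m) == i) && uniq (enum_mset m))%:R.

Definition is_intpart (l : seq nat) : bool := sorted geq l && (0%N \notin l).

Definition e_sym (l : seq nat) : cseries := \big[cs_mul/cs_one]_(i <- l) elem i.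

(* Positivity with respect to the family b_i, for i in D, of series with      *)
(* monomials in M.                                                            *)
Definition positive_in (M : Type) (I : choiceType) (D : pred I)
    (b : I -> M -> rat) (f : M -> rat) : Prop :=
  exists c : {fsfun I -> rat with 0},
    [/\ forall i, i \in finsupp c -> D i,
        forall m, f m = \sum_(i <- finsupp c) c i * b i m
      & forall i, c i != 0 -> 0 < c i].

Definition nc_e_positive (f : ncseries) : Prop :=
  positive_in
    (fun P : {n : nat & {set {set 'I_n}}} => partition (tagged P) [set: _])
    (fun P => e_nc (tagged P)) f.

Definition sym_e_positive (f : cseries) : Prop :=
  positive_in is_intpart e_sym f.

(* Main.v *)
Require Import Defs.
From mathcomp Require Import all_boot all_order all_algebra.
From mathcomp Require Import finmap multiset perm zify.

(* Under rho, e_P becomes (prod_B |B|!) e_lambda, where lambda lists the block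
   sizes of P; so an e-positive expansion in NCSym maps to one in Sym.
   Conversely, rho is injective on series whose coefficients are invariant under
   rearranging words, and x_[n] is such a series because mobius S (one_block n)
   only depends on #|S|. Given an e-positive expansion of x_n, spread the
   coefficient of each e_lambda with |lambda| = n evenly over the partitions of
   type lambda, dividing by prod_i lambda_i!: the resulting positive combination
   of the e_P is invariant and has image x_n, hence equals x_[n]. *)

Set Implicit Arguments.
Unset Strict Implicit.
Unset Printing Implicit Defensive.

Import Order.TTheory GRing.Theory Num.Theory.

Local Open Scope ring_scope.
Local Open Scope mset_scope.

(** * Commutative images of concatenation products and of segmentwise injective words *)

Lemma perm_enum_mset (w : seq nat) (m : {mset nat}) :
  perm_eq w (enum_mset m) = (seq_mset w == m).
Proof.
rewrite -{2}(seq_mset_id m); apply/idP/eqP => [|h]; first by move/eq_seq_msetP.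
exact/eq_seq_msetP.
Qed.

Lemma seq_mset_cat (u v : seq nat) :
  seq_mset (u ++ v) = seq_mset u `+` seq_mset v.
Proof.
by apply/msetP => x; rewrite msetE2 !mset_seqE count_cat.
Qed.

Lemma eq_rho (f g : ncseries) : f =1 g -> rho f =1 rho g.
Proof. by move=> fg m; apply: eq_bigr => w _; rewrite fg. Qed.

(** Cutting after [k] letters is a bijection from the rearrangements of [m] whose prefix has content
    [a] to pairs of rearrangements of [a] and of its complement, provided [a] has size [k]. For
    other sizes the hypothesis on [f] kills both sides. *)
Lemma rho_cat (k : nat) (f g : ncseries) (m : {mset nat}) :
    (forall u, size u != k -> f u = 0) ->
  rho (fun w => f (take k w) * g (drop k w)) m = cs_mul (rho f) (rho g) m.
Proof.
move=> f0; rewrite /cs_mul.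
have fk u : f u = 0 \/ size u = k.
  by have [->|/f0] := eqVneq (size u) k; [right | left].
(* Sort the words by the content [a] of their prefix; each [w] meets exactly one [a]. *)
transitivity (\sum_(w <- permutations (enum_mset m))
    \sum_(a <- sub_msets m | a == seq_mset (take k w))
      f (take k w) * g (drop k w)).
  rewrite /rho !big_seq; apply: eq_bigr => w.
  rewrite mem_permutations perm_enum_mset => /eqP wm.
  under eq_bigl do rewrite -/(pred1 (seq_mset (take k w)) _).
  rewrite -big_filter filter_pred1_uniq ?undup_uniq ?big_seq1 //.
  rewrite mem_sub_msets -wm -{2}(cat_take_drop k w) seq_mset_cat.
  by apply/msubsetP => x; rewrite msetE2 leq_addr.
rewrite (exchange_big_dep xpredT) //= !big_seq; apply: eq_bigr => a.
rewrite mem_sub_msets => am.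
have rhoE : rho f a * rho g (m `\` a) =
    \sum_(u <- permutations (enum_mset a))
      \sum_(v <- permutations (enum_mset (m `\` a))) f u * g v.
  by rewrite big_distrlr.
rewrite rhoE; have [ak|ak] := eqVneq (size (enum_mset a)) k; last first.
  rewrite [RHS]big_seq [RHS]big1 => [|u]; last first.
    rewrite mem_permutations => /perm_size ua; rewrite big1 // => v _.
    by case: (fk u) => [->|ku]; [rewrite mul0r | case/eqP: ak; rewrite -ua].
  rewrite big1 // => w /eqP aw; case: (fk (take k w)) => [->|kw].
    by rewrite mul0r.
  by case/eqP: ak; rewrite aw (perm_size (perm_eq_seq_mset _)).
pose F p := f p.1 * g p.2.
rewrite (eq_bigr (fun w => F (take k w, drop k w))) //.
rewrite -(big_map (fun w => (take k w, drop k w)) (fun p => a == seq_mset p.1)).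
rewrite -big_filter.
transitivity (\sum_(p <- [seq (u, v) | u <- permutations (enum_mset a),
                  v <- permutations (enum_mset (m `\` a))]) F p); last first.
  by rewrite big_allpairs.
apply: perm_big; apply: uniq_perm.
- rewrite filter_uniq // map_inj_in_uniq ?permutations_uniq // => w w' _ _ [tk dk].
  by rewrite -(cat_take_drop k w) tk dk cat_take_drop.
- by rewrite allpairs_uniq ?permutations_uniq // => -[u v] [u' v'].
move=> [u v]; rewrite mem_filter; apply/andP/allpairsP => /=.
  case=> /eqP au /mapP[w]; rewrite mem_permutations perm_enum_mset => /eqP wm.
  case=> uw vw; exists (u, v); split=> //=.
    by rewrite mem_permutations perm_enum_mset au.
  rewrite mem_permutations perm_enum_mset -wm -(cat_take_drop k w) -uw -vw.
  by rewrite seq_mset_cat -au msetDKB.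
case=> -[u' v'] [/= + + [-> ->]].
rewrite !mem_permutations !perm_enum_mset => /eqP ua /eqP vm.
split; first by rewrite ua.
have uk : size u' = k by rewrite -ak -ua (perm_size (perm_eq_seq_mset _)).
apply/mapP; exists (u' ++ v'); last by rewrite -uk take_size_cat ?drop_size_cat.
rewrite mem_permutations perm_enum_mset seq_mset_cat ua vm.
apply/eqP/msetP => x; rewrite !msetE2 subnKC //; exact/msubsetP.
Qed.

(** All rearrangements of [m] contribute the same 0 or 1, and a squarefree monomial of degree [k]
    has [k]! of them. *)
Lemma rho_uniq (k : nat) (m : {mset nat}) :
  rho (fun w => ((size w == k) && uniq w)%:R) m = k`!%:R * elem k m.
Proof.
rewrite /rho /elem big_seq (eq_bigr (fun=> ((size (enum_mset m) == k)
   && uniq (enum_mset m))%:R)); last first.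
  by move=> w; rewrite mem_permutations => wm; rewrite (perm_size wm) (perm_uniq wm).
rewrite -big_seq big_const_seq count_predT iter_addr addr0.
case: eqP => [<-|] /=; last by rewrite mul0rn mulr0.
have [u|_] := boolP (uniq _); last by rewrite mul0rn mulr0.
by rewrite size_permutations // mulr1.
Qed.

(* With [sumn l = n], this is the coefficient of e_P for the partition P of [n]
   into consecutive intervals of lengths l. *)
Definition uniq_segments (l : seq nat) (w : seq nat) : bool :=
  (size w == sumn l) && all uniq (reshape l w).

Definition prod_fact (l : seq nat) : nat := \prod_(i <- l) i`!.

Lemma prod_fact_gt0 l : (0 < prod_fact l)%N.
Proof. by apply: prodn_gt0 => i; rewrite fact_gt0. Qed.

Lemma rho_uniq_segments (l : seq nat) (m : {mset nat}) :
  rho (fun w => (uniq_segments l w)%:R) m = (prod_fact l)%:R * e_sym l m.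
Proof.
rewrite /e_sym /prod_fact; elim: l m => [|k l IHl] m.
  rewrite !big_nil mul1r /rho /cs_one /uniq_segments /=.
  rewrite big_seq (eq_bigr (fun=> (m == mset0)%:R)); last first.
    move=> w; rewrite mem_permutations => wm; rewrite (perm_size wm) andbT.
    congr ((nat_of_bool _)%:R); apply/idP/eqP => [/nilP m0|->]; last by rewrite enum_mset0.
    by rewrite -(seq_mset_id m) m0; apply/msetP => x; rewrite mset_seqE mset0E.
  rewrite -big_seq big_const_seq count_predT iter_addr addr0.
  by case: eqP => [->|_]; rewrite ?mul0rn // enum_mset0.
rewrite !big_cons natrM -/(e_sym l).
set f : ncseries := fun w => ((size w == k) && uniq w)%:R.
set g : ncseries := fun w => (uniq_segments l w)%:R.
transitivity (rho (fun w => f (take k w) * g (drop k w)) m).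
  apply: eq_rho => w; rewrite /f /g /uniq_segments /= -natrM mulnb.
  congr ((nat_of_bool _)%:R); rewrite size_take_min size_drop.
  (* The [minn] conjunct excludes words shorter than [k], for which [size w - k] truncates to 0. *)
  have -> : (size w == k + sumn l)%N =
      (minn k (size w) == k) && (size w - k == sumn l)%N by lia.
  by case: (_ == k); case: (_ == sumn l) => //=; rewrite andbF.
rewrite rho_cat => [|u /negPf]; last by rewrite /f => ->.
rewrite /cs_mul mulr_sumr; apply: eq_bigr => a _.
by rewrite rho_uniq IHl mulrACA.
Qed.

(** * Invariance of [rho] under reordering places *)

Lemma rho_size0 (n : nat) (f : ncseries) (m : {mset nat}) :
  (forall w, size w != n -> f w = 0) -> size (enum_mset m) != n -> rho f m = 0.
Proof.
move=> f0 mn; rewrite /rho big_seq big1 // => w; rewrite mem_permutations.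
by move/perm_size => wm; rewrite f0 // wm.
Qed.

Lemma perm_map_nth_iota (s w : seq nat) :
  perm_eq s (iota 0 (size w)) -> perm_eq [seq nth 0%N w j | j <- s] w.
Proof.
move=> sP; apply: (perm_trans (perm_map _ sP)).
by rewrite -[X in perm_eq _ X](mkseq_nth 0%N).
Qed.

(** Reading the letters in the order [s] permutes the rearrangements of any monomial of degree [n],
    so it only reorders the sum. *)
Lemma rho_reindex (n : nat) (s : seq nat) (f g : ncseries) :
    perm_eq s (iota 0 n) ->
    (forall w, size w != n -> f w = 0) -> (forall w, size w != n -> g w = 0) ->
    (forall w, size w = n -> g w = f [seq nth 0%N w j | j <- s]) ->
  rho g =1 rho f.
Proof.
move=> sP f0 g0 gf m.
have [mn|mn] := eqVneq (size (enum_mset m)) n; last first.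
  by rewrite (rho_size0 f0 mn) (rho_size0 g0 mn).
have wn w : w \in permutations (enum_mset m) -> size w = n.
  by rewrite mem_permutations => /perm_size ->.
pose act w := [seq nth 0%N w j | j <- s].
rewrite /rho big_seq (eq_bigr (fun w => f (act w))) => [|w /wn/gf //].
rewrite -big_seq -(big_map act xpredT); apply: perm_big.
have act_uniq : uniq (map act (permutations (enum_mset m))).
  rewrite map_inj_in_uniq ?permutations_uniq // => w w' /wn wsz /wn wsz'.
  move=> /eq_in_map eqw; apply: (@eq_from_nth _ 0%N); first by rewrite wsz.
  by move=> i; rewrite wsz => lt_in; rewrite eqw // (perm_mem sP) mem_iota.
apply: uniq_perm; rewrite ?permutations_uniq //.
(* An injective map of a finite set into itself is onto. *)
have [|//|//] := uniq_min_size act_uniq (s2 := permutations (enum_mset m)).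
  move=> _ /mapP[w wP ->]; have wsz := wn w wP; move: wP.
  rewrite !mem_permutations; apply: perm_trans.
  by apply: perm_map_nth_iota; rewrite wsz.
by rewrite size_map.
Qed.

(** * Types of set partitions and the images of the [e_nc P] *)

Definition block_sizes n (P : {set {set 'I_n}}) : seq nat :=
  sort geq [seq #|pred_of_set B| | B <- enum P].

Lemma geq_total : total geq.
Proof. by move=> a b; apply: leq_total. Qed.

Lemma geq_trans : transitive geq.
Proof. by move=> a b c /= ba cb; apply: leq_trans cb ba. Qed.

Lemma geq_anti : antisymmetric geq.
Proof. by move=> a b /= /andP[ba ab]; apply/eqP; rewrite eqn_leq ab. Qed.

Lemma perm_block_sizes n (P : {set {set 'I_n}}) :
  perm_eq (block_sizes P) [seq #|pred_of_set B| | B <- enum P].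
Proof. by rewrite perm_sort. Qed.

Lemma block_sizes_intpart n (P : {set {set 'I_n}}) :
  partition P [set: 'I_n] -> is_intpart (block_sizes P).
Proof.
case/and3P=> _ _ P0; rewrite /is_intpart sort_sorted /=; last exact: geq_total.
rewrite (perm_mem (perm_block_sizes P)); apply/negP => /mapP[B].
by rewrite mem_enum => + /esym/cards0_eq B0; rewrite B0; apply/negP.
Qed.

Lemma sumn_block_sizes n (P : {set {set 'I_n}}) :
  partition P [set: 'I_n] -> sumn (block_sizes P) = n.
Proof.
move=> /card_partition; rewrite cardsT card_ord => nE.
rewrite (perm_sumn (perm_block_sizes P)) sumnE big_map big_enum /=.
exact: esym.
Qed.

(** This blockwise form becomes [uniq_segments] once the blocks are laid out one after another. *)
Lemma e_nc_uniq n (P : {set {set 'I_n}}) (w : seq nat) :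
  e_nc P w = ((size w == n) &&
    all (fun B : {set 'I_n} => uniq [seq nth 0%N w (val j) | j <- enum B])
      (enum P))%:R.
Proof.
rewrite /e_nc; congr ((nat_of_bool (_ && _))%:R); apply/idP/allP.
  move=> /forall_inP e B; rewrite mem_enum => /e /forall_inP eB.
  apply/dinjectiveP => j k jB kB jk; apply/eqP; apply: contraTT (eB j jB) => j'k.
  by apply/forall_inPn; exists k => //; rewrite j'k jk eqxx.
move=> e; apply/forall_inP => B BP; apply/forall_inP => j jB.
apply/forall_inP => k kB; apply/implyP; apply: contraNneq => jk; apply/eqP.
by have := e B; rewrite mem_enum => /(_ BP)/dinjectiveP; apply.
Qed.

(** Reading the places block by block turns [P] into consecutive intervals, and by [rho_reindex]
    this leaves the image unchanged. *)
Lemma rho_e_nc n (P : {set {set 'I_n}}) (m : {mset nat}) :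
    partition P [set: 'I_n] ->
  rho (e_nc P) m = (prod_fact (block_sizes P))%:R * e_sym (block_sizes P) m.
Proof.
move=> PT; rewrite -rho_uniq_segments.
(* The blocks themselves are sorted by size, so that their lengths in order are exactly
   [block_sizes P]. *)
pose bs := sort (relpre (fun B : {set 'I_n} => #|B|) geq) (enum P).
have bsP : perm_eq bs (enum P) by rewrite perm_sort.
have bsE : block_sizes P = [seq #|pred_of_set B| | B <- bs] by rewrite -sort_map.
pose L := [seq enum (pred_of_set B) | B <- bs].
have LE : shape L = block_sizes P.
  by rewrite bsE /shape -map_comp; apply: eq_map => B /=; rewrite -cardE.
have szL : size (flatten L) = n by rewrite size_flatten LE sumn_block_sizes.
have LT : {subset enum 'I_n <= flatten L}.
  move=> i _; have /and3P[/eqP PT' _ _] := PT.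
  have : i \in [set: 'I_n] by rewrite inE.
  rewrite -PT' => /bigcupP[B BP iB]; apply/flattenP; exists (enum B).
    by apply: map_f; rewrite (perm_mem bsP) mem_enum.
  by rewrite mem_enum.
(* The list [flatten L] contains every place and has length only [n], so nothing repeats. *)
have LP : perm_eq (flatten L) (enum 'I_n).
  have szn : (size (flatten L) <= size (enum 'I_n))%N by rewrite szL size_enum_ord.
  have [_ eqL] := uniq_min_size (enum_uniq _) LT szn.
  rewrite perm_sym uniq_perm ?enum_uniq // (leq_size_uniq (enum_uniq 'I_n)) //.
have segE w : size w != n -> (uniq_segments (block_sizes P) w)%:R = 0 :> rat.
  by rewrite /uniq_segments sumn_block_sizes // => /negPf ->.
apply: (@rho_reindex n (map val (flatten L))) => //.
- by rewrite -val_enum_ord perm_map.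
- by move=> w /negPf wn; rewrite /e_nc wn.
move=> w wn; rewrite e_nc_uniq wn eqxx /uniq_segments -LE -map_comp.
rewrite size_map size_flatten eqxx /=; congr ((nat_of_bool _)%:R).
rewrite -(perm_all _ bsP) -map_reshape flattenK all_map.
by rewrite /L all_map; apply: eq_all => B.
Qed.

(** If two of the lists had the same underlying set, the head of one would reappear in the other;
    nonemptiness provides that head. *)
Lemma uniq_sets_of_flatten (T : finType) (L : seq (seq T)) :
    [::] \notin L -> uniq (flatten L) -> uniq [seq [set x in s] | s <- L].
Proof.
elim: L => //= s L IHL; rewrite inE negb_or cat_uniq.
case: s => // x s /= L0 /and3P[_ sL uL]; rewrite IHL // andbT.
apply/mapP => -[s' s'L eq_s]; case/hasP: sL; exists x; last by rewrite /= inE eqxx.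
apply/flattenP; exists s' => //.
have : x \in [set y in x :: s] by rewrite !inE eqxx.
by rewrite eq_s inE.
Qed.

(** Cut [enum 'I_n] into consecutive intervals of lengths [l]. This makes the averaging in
    [e_positive_lift] run over a nonempty class. *)
Lemma block_sizes_onto n (l : seq nat) :
    is_intpart l -> sumn l = n ->
  exists2 P : {set {set 'I_n}}, partition P [set: 'I_n] & block_sizes P = l.
Proof.
case/andP=> l_sorted l0 ln; pose L := reshape l (enum 'I_n).
have szE : size (enum 'I_n) = sumn l by rewrite size_enum_ord.
have LE : shape L = l by rewrite reshapeKl // szE.
have LK : flatten L = enum 'I_n by rewrite reshapeKr // szE.
have L0 : [::] \notin L.
  by apply: contra l0 => L0; rewrite -LE; apply: (map_f size L0).
have uL : uniq (flatten L) by rewrite LK enum_uniq.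
have uS := uniq_sets_of_flatten L0 uL.
pose P := [set B in [seq [set x in s] | s <- L]].
have PE : perm_eq (enum P) [seq [set x in s] | s <- L].
  by apply: uniq_perm; rewrite ?enum_uniq // => B; rewrite mem_enum inE.
have cardE s : s \in L -> #|[set x in s]| = size s.
  move=> sL; rewrite cardsE; apply/card_uniqP; move: uL sL.
  elim: (L) => //= s' L' IH; rewrite cat_uniq inE => /and3P[us' _ uL'].
  by case/predU1P => [->|/(IH uL')].
have szP : [seq #|pred_of_set B| | B <- [seq [set x in s] | s <- L]] = l.
  by rewrite -map_comp -[RHS]LE; apply/eq_in_map => s /cardE.
have covP : cover P = [set: 'I_n].
  apply/setP => i; rewrite inE; have : i \in flatten L by rewrite LK mem_enum.
  case/flattenP => s sL si; apply/bigcupP; exists [set x in s]; last by rewrite inE.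
  by rewrite inE map_f.
exists P.
  apply/and3P; split; first by rewrite covP.
    (* Disjointness follows by counting: the block sizes add up to the size of the union. *)
    rewrite /trivIset covP cardsT card_ord -big_enum (perm_big _ PE) /=.
    by rewrite -(big_map (fun B : {set 'I_n} => #|B|) xpredT id) szP -sumnE ln.
  rewrite inE; apply/mapP => -[[|x s] sL]; first by rewrite sL in L0.
  by move/setP/(_ x); rewrite !inE eqxx.
apply: (sorted_eq geq_trans geq_anti); rewrite ?sort_sorted //; first exact: geq_total.
by rewrite -[X in perm_eq _ X]szP (perm_trans (perm_block_sizes P)) ?perm_map.
Qed.

(** * Place permutations and invariance under rearrangement *)

Section PlacePermutation.

Variables (n : nat) (s : 'S_n).

Definition place_set (P : {set {set 'I_n}}) : {set {set 'I_n}} :=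
  [set s @: (B : {set 'I_n}) | B in P].

Lemma place_set_inj : injective place_set.
Proof. by apply/imset_inj/imset_inj/perm_inj. Qed.

Lemma card_place_set P : #|place_set P| = #|P|.
Proof. by rewrite card_imset //; apply/imset_inj/perm_inj. Qed.

Lemma block_sizes_place_set P : block_sizes (place_set P) = block_sizes P.
Proof.
have sP : perm_eq (enum (place_set P)) [seq s @: (B : {set 'I_n}) | B <- enum P].
  apply: uniq_perm; rewrite ?enum_uniq //.
    by rewrite map_inj_uniq ?enum_uniq //; apply/imset_inj/perm_inj.
  move=> B; rewrite mem_enum; apply/imsetP/mapP => -[C CP ->].
    by exists C; rewrite ?mem_enum.
  by exists C => //; rewrite mem_enum in CP.
apply/(perm_sortP geq_total geq_trans geq_anti).
apply: perm_trans (perm_map _ sP) _; rewrite -map_comp.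
rewrite (eq_map (g := fun B : {set 'I_n} => #|B|)) // => B /=.
by rewrite card_imset //; apply: perm_inj.
Qed.

Lemma partition_place_set P :
  partition (place_set P) [set: 'I_n] = partition P [set: 'I_n].
Proof.
rewrite -(imset_partition P [set: 'I_n] (@perm_inj _ s)); congr (partition _ _).
by apply/esym/setP => i; rewrite inE -(permKV s i) imset_f.
Qed.

End PlacePermutation.

(* Both p_nc and e_nc are of this form, with [r a b] being [b] and
   [~~ a ==> ~~ b] respectively. *)
Definition respects (r : bool -> bool -> bool) n (P : {set {set 'I_n}})
    (w : seq nat) : bool :=
  (size w == n) && [forall B in P, forall j in B, forall k in B,
     r (j == k) (nth 0%N w j == nth 0%N w k)].

Lemma respects_place_set r n (s : 'S_n) (P : {set {set 'I_n}}) (w w' : seq nat) :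
    size w = n -> size w' = n ->
    (forall i : 'I_n, nth 0%N w i = nth 0%N w' (s i)) ->
  respects r (place_set s P) w' = respects r P w.
Proof.
move=> wn w'n ww'; rewrite /respects wn w'n eqxx /=.
apply/forall_inP/forall_inP => e B.
  move=> BP; apply/forall_inP => j jB; apply/forall_inP => k kB.
  have /forall_inP/(_ (s j)) := e _ (imset_f (fun C : {set _} => s @: C) BP).
  rewrite imset_f // => /(_ isT)/forall_inP/(_ (s k)).
  by rewrite imset_f // !ww' (inj_eq perm_inj); apply.
case/imsetP => {}B BP ->; have /forall_inP eB := e B BP.
apply/forall_inP => _ /imsetP[j jB ->]; apply/forall_inP => _ /imsetP[k kB ->].
by rewrite -!ww' (inj_eq perm_inj); move/forall_inP: (eB j jB); apply.
Qed.

(** A rearrangement comes from a place permutation [s]; reindexing the sum by [place_set s] absorbs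
    it, as [G] is constant on orbits. *)
Lemma sum_respects_perm r n (G : {set {set 'I_n}} -> rat) (w w' : seq nat) :
    (forall s P, G (place_set s P) = G P) -> perm_eq w w' ->
  \sum_P G P * (respects r P w)%:R = \sum_P G P * (respects r P w')%:R.
Proof.
move=> Gs ww'; have [wn|wn] := eqVneq (size w) n; last first.
  by apply: eq_bigr => P _; rewrite /respects -(perm_size ww') (negPf wn).
have w'n : size w' == n by rewrite -(perm_size ww') wn.
have /tuple_permP[s wE] : perm_eq w (Tuple w'n) by [].
rewrite [RHS](reindex_inj (@place_set_inj _ s)); apply: eq_bigr => P _.
rewrite Gs (@respects_place_set _ _ _ _ w) ?wn //; first exact/eqP.
by move=> i; rewrite wE -tnth_nth tnth_mktuple (tnth_nth 0%N).
Qed.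

Lemma x_nc_perm n (w w' : seq nat) :
  perm_eq w w' -> x_nc (one_block n) w = x_nc (one_block n) w'.
Proof.
(* The Möbius value below the one-block partition, where every block lies in the single block,
   extended by 0 to families that are not partitions. *)
pose G (P : {set {set 'I_n}}) : rat :=
  if partition P [set: 'I_n] then (-1) ^+ #|P|.-1 * (#|P|.-1)`!%:R else 0.
have x_ncE u : x_nc (one_block n) u =
    \sum_P G P * (respects (fun _ b => b) P u)%:R.
  rewrite /x_nc big_mkcond; apply: eq_bigr => P _; rewrite /G.
  have -> : refines P (one_block n).
    apply/forall_inP => A _; apply/exists_inP.
    by exists [set: 'I_n]; rewrite ?set11 ?subsetT.
  rewrite andbT; case: ifP => _; last by rewrite mul0r.
  rewrite /mobius big_set1 (_ : [set A in P | A \subset [set: 'I_n]] = P) //.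
  by apply/setP => A; rewrite inE subsetT andbT.
move=> ww'; rewrite !x_ncE; apply: sum_respects_perm => // s P.
by rewrite /G partition_place_set card_place_set.
Qed.

(** * Positive expansions and their transfer along [rho] *)

Lemma positive_in_seq (M : Type) (I : choiceType) (D : pred I)
    (b : I -> M -> rat) (f : M -> rat) (J : eqType) (r : seq J)
    (g : J -> I) (d : J -> rat) :
    (forall j, j \in r -> D (g j)) -> (forall j, j \in r -> 0 <= d j) ->
    (forall m, f m = \sum_(j <- r) d j * b (g j) m) ->
  positive_in D b f.
Proof.
move=> Dg d0 fE; pose S : {fset I} := seq_fset tt (map g r).
(* The map [g] may identify indices, as when set partitions share a type, so coefficients are
   collected along its fibres. Some totals may vanish, hence the support may be smaller than [S]. *)
pose C i := \sum_(j <- r | g j == i) d j.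
pose c : {fsfun I -> rat with 0} := [fsfun i in S => C i].
have cS i : i \in S -> c i = C i by move=> iS; rewrite fsfunE iS.
have cNS i : i \notin S -> c i = 0 by move=> /negPf iS; rewrite fsfunE iS.
have sub_S : (finsupp c `<=` S)%fset.
  by apply/fsubsetP => i; rewrite mem_finsupp; apply: contraR => /cNS ->.
exists c; split=> [i /(fsubsetP sub_S)|m|i ci0].
- by rewrite seq_fsetE => /mapP[j jr ->]; apply: Dg.
- rewrite fE (big_fset_incl _ sub_S) => [|i _]; last first.
    by rewrite mem_finsupp negbK => /eqP ->; rewrite mul0r.
  rewrite [RHS]big_seq (eq_bigr (fun i => \sum_(j <- r | g j == i) d j * b (g j) m)).
    rewrite -big_seq (exchange_big_dep xpredT) //= !big_seq.
    apply: eq_bigr => j jr.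
    have gS : g j \in S by rewrite seq_fsetE map_f.
    under eq_bigl do rewrite eq_sym -/(pred1 (g j) _).
    by rewrite -big_filter filter_pred1_uniq ?fset_uniq // big_seq1.
  move=> i iS; rewrite cS // /C mulr_suml.
  by apply: eq_bigr => j /eqP ->.
have iS : i \in S by apply: contraR ci0 => /cNS ->.
rewrite lt_neqAle eq_sym ci0 cS // /C big_seq_cond sumr_ge0 // => j /andP[jr _].
exact: d0.
Qed.

Lemma rho_sum (J : Type) (r : seq J) (d : J -> rat) (F : J -> ncseries)
    (m : {mset nat}) :
  rho (fun w => \sum_(j <- r) d j * F j w) m = \sum_(j <- r) d j * rho (F j) m.
Proof.
rewrite /rho exchange_big; apply: eq_bigr => j _.
by rewrite mulr_sumr.
Qed.

(** On an invariant series, [rho] multiplies the coefficient of [w] by the number of its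
    rearrangements, which is positive because [w] is one of them. *)
Lemma rho_inj_perm (f g : ncseries) :
    (forall w w', perm_eq w w' -> f w = f w') ->
    (forall w w', perm_eq w w' -> g w = g w') ->
  forall w, rho f (seq_mset w) = rho g (seq_mset w) -> f w = g w.
Proof.
have rhoE h : (forall w w', perm_eq w w' -> h w = h w') -> forall w,
    rho h (seq_mset w) = h w *+ size (permutations (enum_mset (seq_mset w))).
  move=> hP w; rewrite /rho big_seq (eq_bigr (fun=> h w)) => [|u].
    by rewrite -big_seq big_const_seq count_predT iter_addr addr0.
  by rewrite mem_permutations perm_enum_mset => /eqP/eq_seq_msetP /hP.
move=> fP gP w; rewrite !rhoE //; apply: pmulrnI.
by rewrite -has_predT; apply/hasP; exists w; rewrite // mem_permutations perm_enum_mset.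
Qed.

(** A nonzero multiple of [e_sym l] is the image of a series supported on words of length
    [sumn l]. *)
Lemma e_sym_size0 (n : nat) (l : seq nat) (m : {mset nat}) :
  size (enum_mset m) = n -> sumn l != n -> e_sym l m = 0.
Proof.
move=> mn ln; have := rho_uniq_segments l m.
rewrite (rho_size0 (n := sumn l)) ?mn 1?eq_sym // => [/esym/eqP|w /negPf wl].
  by rewrite mulf_eq0 pnatr_eq0 -leqn0 leqNgt prod_fact_gt0 => /eqP.
by rewrite /uniq_segments wl.
Qed.

Lemma x_nc_size0 n (w : seq nat) : size w != n -> x_nc (one_block n) w = 0.
Proof.
by move=> /negPf wn; rewrite /x_nc big1 // => P _; rewrite /p_nc wn mulr0.
Qed.

Lemma e_positive_rho (f : ncseries) : nc_e_positive f -> sym_e_positive (rho f).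
Proof.
case=> c [cP fE c_gt0].
pose J := {n : nat & {set {set 'I_n}}}.
apply: (@positive_in_seq _ _ _ _ _ _ (finsupp c) (fun P : J => block_sizes (tagged P))
  (fun P : J => c P * (prod_fact (block_sizes (tagged P)))%:R)).
- by move=> P /cP; apply: block_sizes_intpart.
- move=> P; rewrite mem_finsupp => /c_gt0 cP_gt0.
  by rewrite mulr_ge0 ?ler0n // ltW.
move=> m; rewrite (eq_rho fE) rho_sum !big_seq; apply: eq_bigr => P /cP PT.
by rewrite rho_e_nc // mulrA.
Qed.

Lemma e_positive_lift n (f : ncseries) :
    (forall w, size w != n -> f w = 0) ->
    (forall w w', perm_eq w w' -> f w = f w') ->
  sym_e_positive (rho f) -> nc_e_positive f.
Proof.
move=> f0 fperm [c [c_intpart fE c_gt0]].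
pose parts l := [set P : {set {set 'I_n}} | partition P [set: 'I_n] & block_sizes P == l].
(* The factor [prod_fact] cancels the one in [rho_e_nc]; the cardinality cancels when the sum runs
   over all partitions of one type. *)
pose d (P : {set {set 'I_n}}) : rat :=
  c (block_sizes P) / (#|parts (block_sizes P)| * prod_fact (block_sizes P))%:R.
pose r := [seq P : {set {set 'I_n}} <- enum {set {set 'I_n}} | partition P [set: 'I_n]].
pose g (P : {set {set 'I_n}}) := Tagged (fun k => {set {set 'I_k}}) P.
have c_ge0 l : 0 <= c l by have [->|/c_gt0/ltW] := eqVneq (c l) 0.
apply: (@positive_in_seq _ _ _ _ _ _ r g d).
- by move=> P; rewrite mem_filter => /andP[].
- by move=> P _; rewrite /d divr_ge0 ?ler0n.
pose D w := \sum_(P <- r) d P * e_nc P w.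
have D_E w : D w = \sum_P (if partition P [set: 'I_n] then d P else 0) *
    (respects (fun a b => ~~ a ==> ~~ b) P w)%:R.
  rewrite /D /r big_filter big_enum_cond /= big_mkcond; apply: eq_bigr => P _.
  by case: ifP; rewrite ?mul0r.
have Dperm w w' : perm_eq w w' -> D w = D w'.
  move=> ww'; rewrite !D_E; apply: sum_respects_perm => // s P.
  by rewrite partition_place_set /d block_sizes_place_set.
move=> w; rewrite -/(D w); have [wn|wn] := eqVneq (size w) n; last first.
  by rewrite f0 // /D big1 // => P _; rewrite /e_nc (negPf wn) mulr0.
apply: rho_inj_perm => //; rewrite fE rho_sum; set m := seq_mset w.
have mn : size (enum_mset m) = n by rewrite -wn (perm_size (perm_eq_seq_mset w)).
(* Group the set partitions by type; a type outside the support of [c] contributes 0 on both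
   sides. *)
transitivity (\sum_(P <- r) \sum_(l <- finsupp c | l == block_sizes P)
    c l / #|parts l|%:R * e_sym l m); last first.
  rewrite !big_seq; apply: eq_bigr => P; rewrite mem_filter => /andP[PT _].
  rewrite rho_e_nc // /d natrM invfM !mulrA divfK; last first.
    by rewrite pnatr_eq0 -lt0n prod_fact_gt0.
  have [lc|lc] := boolP (block_sizes P \in finsupp c).
    by rewrite -big_filter filter_pred1_uniq ?fset_uniq // big_seq1.
  rewrite [LHS]big_seq_cond big1 => [|l /andP[lc' /eqP lP]].
    by move: lc; rewrite mem_finsupp negbK => /eqP ->; rewrite !mul0r.
  by rewrite -lP lc' in lc.
rewrite (exchange_big_dep xpredT) //= big_seq [RHS]big_seq; apply: eq_bigr => l lc.
rewrite (eq_bigl (fun P => block_sizes P == l)); last by move=> P; rewrite eq_sym.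
rewrite big_filter_cond big_enum_cond /=.
rewrite (eq_bigl (mem (parts l))); last by move=> P; rewrite !inE.
rewrite sumr_const -[RHS]mulr_natl.
(* The expansion may a priori involve other degrees. There [parts l] is empty and its inverse
   cardinality is 0 by convention, but [e_sym l] also vanishes at [m]. *)
have [ln|ln] := eqVneq (sumn l) n; last by rewrite (e_sym_size0 mn ln) !mulr0.
rewrite mulrA mulrCA divff ?mulr1 // pnatr_eq0 -lt0n.
have [P PT Pl] := block_sizes_onto (c_intpart l lc) ln.
by apply/card_gt0P; exists P; rewrite inE PT Pl eqxx.
Qed.

Theorem theorem4p5 (n : nat) (hn : (1 <= n)%N) :
  nc_e_positive (x_nc (one_block n)) <-> sym_e_positive (x_sym n).
Proof.
split; first exact: e_positive_rho.
by apply: e_positive_lift; [apply: x_nc_size0 | apply: x_nc_perm].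
Qed.
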